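(* Let $n\ge 2$ and let $D$ be a bounded domain in $\mathbb{R}^n$. Then for all $x,y\in D$, $$\zeta_D(x,y)\le i_D^*(x,y)\le 2\,\zeta_D(x,y).$$ Moreover, both inequalities are sharp, in the sense that the constants $1$ (on the left) and $2$ (on the right) are best possible: if $c,C>0$ are constants such that $c\,\zeta_D(x,y)\le i_D^*(x,y)\le C\,\zeta_D(x,y)$ for all bounded domains $D\subset\mathbb{R}^n$ and all $x,y\in D$, then $c\le 1$ and $C\ge 2$.
   Context: A domain is a nonempty open connected set. For a bounded domain $D\subset\mathbb{R}^n$ and $z\in D$, $\delta_D(z)=\inf\{|z-\xi|:\xi\in\partial D\}$, $d(D)$ is the Euclidean diameter of $D$, and $\eta_D(z)=\delta_D(z)\,(d(D)-\delta_D(z))$. For $x,y\in D$ define $$\zeta_D(x,y)=\log\left(1+\frac{d(D)\,|x-y|}{\min\{\eta_D(x),\eta_D(y)\}}\right),\qquad i_D^*(x,y)=2\log\frac{\eta_D(x)+\eta_D(y)+d(D)\,|x-y|}{2\sqrt{\eta_D(x)\,\eta_D(y)}}.$$ *)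

(* Defs.v *)
From mathcomp Require Import all_boot all_order all_algebra.
From mathcomp Require Import all_classical all_reals all_analysis.
Set Implicit Arguments.
Unset Strict Implicit.
Unset Printing Implicit Defensive.
Import Order.TTheory GRing.Theory Num.Theory.
Import numFieldNormedType.Exports.
Local Open Scope classical_set_scope.
Local Open Scope ring_scope.

(* R^n is 'rV[R]_n.  Its library norm `|x| is the sup norm, which induces the
   usual topology and bounded sets but not the Euclidean distance, so the
   latter is defined here. *)
Definition eucl_dist {R : realType} {n : nat} (x y : 'rV[R]_n) : R :=
  Num.sqrt (\sum_(i < n) (x ord0 i - y ord0 i) ^+ 2).

Definition boundary {T : topologicalType} (A : set T) : set T :=
  closure A `\` interior A.

Definition bounded_domain {R : realType} {n : nat} (D : set 'rV[R]_n) : Prop :=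
  [/\ D !=set0, open D, connected D & bounded_set D].

Definition bdist {R : realType} {n : nat} (D : set 'rV[R]_n) (z : 'rV[R]_n)
    : R :=
  inf [set eucl_dist z xi | xi in boundary D].

Definition eucl_diam {R : realType} {n : nat} (D : set 'rV[R]_n) : R :=
  sup [set eucl_dist x y | x in D & y in D].

Definition eta {R : realType} {n : nat} (D : set 'rV[R]_n) (z : 'rV[R]_n) : R :=
  bdist D z * (eucl_diam D - bdist D z).

Definition zeta {R : realType} {n : nat} (D : set 'rV[R]_n) (x y : 'rV[R]_n)
    : R :=
  ln (1 + eucl_diam D * eucl_dist x y / Num.min (eta D x) (eta D y)).

Definition istar {R : realType} {n : nat} (D : set 'rV[R]_n) (x y : 'rV[R]_n)
    : R :=
  2 * ln ((eta D x + eta D y + eucl_diam D * eucl_dist x y)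
          / (2 * Num.sqrt (eta D x * eta D y))).

(* Main.v *)
Require Import Defs.
From mathcomp Require Import all_boot all_order all_algebra.
From mathcomp Require Import all_classical all_reals all_analysis.
From mathcomp Require Import ring lra.

(** Write [d] for the diameter of [D], [a = eta(x)], [b = eta(y)] with
    [a <= b], and [t = d |x - y|], so that zeta is [ln (1 + t / a)] and istar
    is [2 ln ((a + b + t) / (2 sqrt (a b)))].

    The left inequality is the inequality of arithmetic and geometric means
    for [a + t] and [b], and holds for all positive weights
    ([ln_ratio_le_two_ln_mean]).  The right one also needs [b <= a + t]: then
    [(a + b + t) / 2 <= a + t], while [sqrt (a b) >= a]
    ([ln_mean_le_ln_ratio]).  That relation between the weights says that eta
    is [d]-Lipschitz ([eta_lipschitz]), which follows from the boundary
    distance being 1-Lipschitz with values between [0] and [d].  The weights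
    are positive because the boundary distance lies strictly between [0] and
    [d]: following a coordinate line from [z] to its exit point gives a
    boundary point at distance less than [d] ([bdist_lt_diam]).

    For sharpness a single domain suffices, the open sup-norm unit ball.  At
    the antipodal points [r e] and [- r e] of a coordinate axis the two weights
    agree by symmetry, and with [s = t / a] the two distances become
    [ln (1 + s)] and [2 ln (1 + s / 2)].  The value [s] is arbitrarily small
    for small [r] ([antipodal_ratio_small]), where the quotient of istar by
    zeta tends to [1], and arbitrarily large as [r] tends to [1]
    ([antipodal_ratio_large]), where the quotient tends to [2].  Only crude
    bounds on eta along the axis enter, never its exact values. *)

Import Order.TTheory GRing.Theory Num.Theory.
Import numFieldNormedType.Exports.
Local Open Scope classical_set_scope.
Local Open Scope ring_scope.
Set Implicit Arguments.
Unset Strict Implicit.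

(** * Euclidean distance on row vectors *)

Section EuclideanDistance.
Context {R : realType} {n : nat}.
Implicit Types (x y z e : 'rV[R]_n) (u v : 'I_n -> R).

Lemma sqr_coord_sum_ge0 u : 0 <= \sum_i u i ^+ 2.
Proof. by apply: sumr_ge0 => i _; exact: sqr_ge0. Qed.

(** With [A] and [B] the lengths of [u] and [v], expanding
    [0 <= sum (B u_i - A v_i)^2] gives [2 A B (A B - sum u_i v_i) >= 0]. *)
Lemma cauchy_schwarz_sum u v :
  \sum_i u i * v i <=
  Num.sqrt (\sum_i u i ^+ 2) * Num.sqrt (\sum_i v i ^+ 2).
Proof.
set A := Num.sqrt (\sum_i u i ^+ 2); set B := Num.sqrt (\sum_i v i ^+ 2).
have A2 : \sum_i u i ^+ 2 = A ^+ 2 by rewrite sqr_sqrtr// sqr_coord_sum_ge0.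
have B2 : \sum_i v i ^+ 2 = B ^+ 2 by rewrite sqr_sqrtr// sqr_coord_sum_ge0.
have zero_sum w : \sum_i w i ^+ 2 = 0 :> R -> forall i : 'I_n, w i = 0.
  move=> /eqP; rewrite psumr_eq0; last by move=> i _; exact: sqr_ge0.
  move=> /allP w0 i; apply/eqP; rewrite -sqrf_eq0; apply: w0.
  by rewrite mem_index_enum.
have [A0|A0] := eqVneq A 0.
  rewrite A0 mul0r big1// => i _; rewrite (zero_sum u) ?mul0r//.
  by rewrite A2 A0 expr0n.
have [B0|B0] := eqVneq B 0.
  rewrite B0 mulr0 big1// => i _; rewrite (zero_sum v) ?mulr0//.
  by rewrite B2 B0 expr0n.
have AB_gt0 : 0 < A * B.
  by rewrite mulr_gt0// lt_neqAle eq_sym (A0, B0) sqrtr_ge0.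
have := sqr_coord_sum_ge0 (fun i => B * u i - A * v i).
have -> : \sum_i (B * u i - A * v i) ^+ 2 =
    2 * (A * B) * (A * B - \sum_i u i * v i).
  transitivity (B ^+ 2 * A ^+ 2 - 2 * (A * B) * (\sum_i u i * v i)
                + A ^+ 2 * B ^+ 2); last by ring.
  rewrite -{1}A2 -{2}B2 !mulr_sumr -sumrB -big_split/=.
  by apply: eq_bigr => i _; ring.
by rewrite pmulr_rge0 ?subr_ge0// mulr_gt0.
Qed.

Lemma eucl_dist_ge0 x y : 0 <= eucl_dist x y.
Proof. exact: sqrtr_ge0. Qed.

Lemma eucl_distC x y : eucl_dist x y = eucl_dist y x.
Proof.
by rewrite /eucl_dist; congr Num.sqrt; apply: eq_bigr => i _; ring.
Qed.

Lemma eucl_distN x y : eucl_dist (- x) (- y) = eucl_dist x y.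
Proof.
by rewrite /eucl_dist; congr Num.sqrt; apply: eq_bigr => i _; rewrite !mxE; ring.
Qed.

Lemma eucl_dist_triangle x y z :
  eucl_dist x z <= eucl_dist x y + eucl_dist y z.
Proof.
set u := fun i => x ord0 i - y ord0 i; set v := fun i => y ord0 i - z ord0 i.
rewrite -[leRHS]ger0_norm ?addr_ge0 ?eucl_dist_ge0// -sqrtr_sqr ler_wsqrtr//.
rewrite sqrrD !sqr_sqrtr ?sqr_coord_sum_ge0//.
have -> : \sum_i (x ord0 i - z ord0 i) ^+ 2 =
    \sum_i u i ^+ 2 + (\sum_i u i * v i) *+ 2 + \sum_i v i ^+ 2.
  by rewrite -sumrMnl -!big_split/=; apply: eq_bigr => i _; rewrite /u /v; ring.
by rewrite lerD2r lerD2l lerMn2r; exact: cauchy_schwarz_sum.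
Qed.

Lemma coord_le_norm x i : `|x ord0 i| <= `|x|.
Proof.
rewrite [leRHS]/Num.Def.normr /= mx_normrE; apply/bigmax_geP; right => /=.
by exists (ord0, i).
Qed.

Lemma norm_le_eucl_dist x y : `|x - y| <= eucl_dist x y.
Proof.
rewrite [leLHS]/Num.Def.normr /= mx_normrE; apply/bigmax_leP; split=> /=.
  exact: eucl_dist_ge0.
move=> [i j] _ /=; rewrite (ord1 i) !mxE -sqrtr_sqr ler_wsqrtr//.
by rewrite (bigD1 j)//= lerDl sumr_ge0// => k _; exact: sqr_ge0.
Qed.

Lemma eucl_dist_le_norm x y : eucl_dist x y <= Num.sqrt n%:R * `|x - y|.
Proof.
rewrite -[`|x - y|]ger0_norm// -sqrtr_sqr -sqrtrM ?ler0n// ler_wsqrtr//.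
rewrite -[n in n%:R]card_ord mulr_natl -sumr_const ler_sum// => i _.
have := coord_le_norm (x - y) i; rewrite !mxE => h.
by rewrite -[leLHS]real_normK ?num_real// lerXn2r// nnegrE.
Qed.

Lemma eucl_dist_line (k : 'I_n) x s t :
  eucl_dist (x + s *: delta_mx ord0 k) (x + t *: delta_mx ord0 k) = `|s - t|.
Proof.
rewrite /eucl_dist (bigD1 k)//= big1 ?addr0.
  by rewrite !mxE !eqxx/= -sqrtr_sqr; congr Num.sqrt; ring.
by move=> i /negPf ik; rewrite !mxE ik/= ; ring.
Qed.

Lemma eucl_dist_ray (k : 'I_n) x t :
  eucl_dist x (x + t *: delta_mx ord0 k) = `|t|.
Proof. by have := eucl_dist_line k x 0 t; rewrite scale0r addr0 sub0r normrN. Qed.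

End EuclideanDistance.

(** * Boundary distance and the metric weight of a bounded domain *)

Section BoundedDomain.
Context {R : realType} {n : nat}.
Variable D : set 'rV[R]_n.
Hypothesis domD : bounded_domain D.
Variable k : 'I_n.
Implicit Types (x y z p : 'rV[R]_n).

Let openD : open D. Proof. by have [] := domD. Qed.

Local Notation e := (delta_mx ord0 k : 'rV[R]_n).

Let norm_line_le x s t : `|(x + s *: e) - (x + t *: e)| <= `|s - t|.
Proof. by rewrite -(eucl_dist_line k x); exact: norm_le_eucl_dist. Qed.

Lemma open_ball_sub z : D z ->
  exists2 r : R, 0 < r & forall y, `|z - y| < r -> D y.
Proof.
move=> Dz; have /nbhs_ballP[r /= r0 rD] : nbhs z D by exact: open_nbhs_nbhs.
by exists r => // y zy; apply: rD; rewrite -ball_normE.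
Qed.

Lemma eucl_dist_le_diam x y : D x -> D y -> eucl_dist x y <= eucl_diam D.
Proof.
move=> Dx Dy; apply: ub_le_sup; last by exists x => //; exists y.
have [_ _ _ [M [_ MD]]] := domD.
have {}MD z : D z -> `|z| <= M + 1 by apply: MD; rewrite ltrDl.
exists (Num.sqrt n%:R * (M + 1 + (M + 1))) => _ [a Da [b Db <-]].
apply: le_trans (eucl_dist_le_norm a b) _.
rewrite ler_wpM2l ?sqrtr_ge0// (le_trans (ler_normB _ _))//.
by rewrite lerD// MD.
Qed.

(** Since [D] is open, the supremum [T] of the times at which the line
    [z + t e] is in [D] is an exit point: the line is in [D] at times
    arbitrarily close to [T], but not at [T]. *)
Lemma boundary_on_line z M : D z -> (forall t, D (z + t *: e) -> t <= M) ->
  exists2 p, boundary D p & eucl_dist z p <= M.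
Proof.
move=> Dz ubM; pose S := [set t : R | D (z + t *: e)].
have S0 : S 0 by rewrite /S/= scale0r addr0.
have supS : has_sup S by split; [exists 0 | exists M].
set T := sup S.
have T0 : 0 <= T by exact: ub_le_sup (supS.2) _ S0.
exists (z + T *: e); last first.
  by rewrite eucl_dist_ray ger0_norm//; apply: ge_sup => //; exists 0.
split.
  move=> B /nbhs_ballP[r /= r0 rB].
  have [t St Tt] := sup_adherent r0 supS.
  have tT : t <= T by exact: ub_le_sup (supS.2) _ St.
  exists (z + t *: e); split => //; apply: rB; rewrite -ball_normE /=.
  apply: le_lt_trans (norm_line_le _ _ _) _.
  by rewrite ger0_norm ?subr_ge0// ltrBlDr -ltrBlDl.
move=> /interior_subset /open_ball_sub[r r0 rD].
have /(ub_le_sup supS.2) : S (T + r / 2).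
  apply: rD; apply: le_lt_trans (norm_line_le _ _ _) _.
  rewrite opprD addrA subrr sub0r normrN gtr0_norm ?divr_gt0//.
  by rewrite ltr_pdivrMr// ltr_pMr// ltr1n.
by rewrite -/T gerDl leNgt divr_gt0.
Qed.

Let boundary_neq0 : boundary D !=set0.
Proof.
have [[z Dz] _ _ _] := domD.
have [|p Bp _] := @boundary_on_line z (eucl_diam D) Dz; last by exists p.
move=> t Dt; apply: le_trans (eucl_dist_le_diam Dz Dt).
by rewrite eucl_dist_ray; exact: ler_norm.
Qed.

Lemma bdist_le z p : boundary D p -> bdist D z <= eucl_dist z p.
Proof.
move=> Bp; apply: ge_inf; last by exists p.
by exists 0 => _ [q _ <-]; exact: eucl_dist_ge0.
Qed.

Lemma bdist_le_line z M : D z -> (forall t, D (z + t *: e) -> t <= M) ->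
  bdist D z <= M.
Proof.
move=> Dz /(boundary_on_line Dz)[p /(bdist_le z) zp pM].
exact: le_trans zp pM.
Qed.

(** The infimum of an empty set is [0], so this direction relies on the boundary
    being nonempty. *)
Lemma le_bdist z r : (forall p, boundary D p -> r <= eucl_dist z p) ->
  r <= bdist D z.
Proof.
move=> rz; apply: lb_le_inf.
  by have [p Bp] := boundary_neq0; exists (eucl_dist z p); exists p.
by move=> _ [p Bp <-]; exact: rz.
Qed.

Lemma bdist_gt0 z : D z -> 0 < bdist D z.
Proof.
move=> /open_ball_sub[r r0 rD]; apply: lt_le_trans r0 _.
apply: le_bdist => p [_ nDp]; apply: le_trans (norm_le_eucl_dist z p).
rewrite leNgt; apply/negP => /rD Dp; apply: nDp.
by move: openD => /interior_id ->.
Qed.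

(** A neighbourhood of [z] extends the chord of [D] through [z] a little
    backwards, so the forward exit time falls short of the diameter. *)
Lemma bdist_lt_diam z : D z -> bdist D z < eucl_diam D.
Proof.
move=> Dz; have [r r0 rD] := open_ball_sub Dz.
apply: le_lt_trans (_ : eucl_diam D - r / 2 < _); last first.
  by rewrite gtrBl divr_gt0.
have Db : D (z + (- (r / 2)) *: e).
  apply: rD; apply: le_lt_trans (norm_le_eucl_dist _ _) _.
  rewrite eucl_dist_ray normrN gtr0_norm ?divr_gt0//.
  by rewrite ltr_pdivrMr// ltr_pMr// ltr1n.
apply: bdist_le_line => // t Dt; rewrite lerBrDr.
apply: le_trans (eucl_dist_le_diam Dt Db).
by rewrite eucl_dist_line opprK ler_norm.
Qed.

Lemma bdist_lipschitz x y : bdist D x <= bdist D y + eucl_dist x y.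
Proof.
rewrite -lerBlDr; apply: le_bdist => p /(bdist_le x) xp.
rewrite lerBlDr addrC; exact: le_trans xp (eucl_dist_triangle x y p).
Qed.

Lemma eta_gt0 z : D z -> 0 < eta D z.
Proof.
by move=> Dz; rewrite mulr_gt0 ?bdist_gt0// subr_gt0 bdist_lt_diam.
Qed.

Lemma eucl_diam_gt0 : 0 < eucl_diam D.
Proof.
have [[z Dz] _ _ _] := domD.
exact: lt_trans (bdist_gt0 Dz) (bdist_lt_diam Dz).
Qed.

(** The function [s (d - s)] has slope [d - 2 s], which lies in [[-d, d]] for
    [0 <= s <= d], and the boundary distance is 1-Lipschitz. *)
Lemma eta_lipschitz x y : D x -> D y ->
  eta D y <= eta D x + eucl_diam D * eucl_dist x y.
Proof.
move=> Dx Dy; rewrite /eta.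
have := bdist_gt0 Dx; have := bdist_gt0 Dy.
have := bdist_lt_diam Dx; have := bdist_lt_diam Dy.
have := bdist_lipschitz x y; have := bdist_lipschitz y x.
rewrite (eucl_distC y x).
move: (bdist D x) (bdist D y) (eucl_diam D) (eucl_dist x y) => u v d t.
move=> vu uv vd ud v0 u0.
have [uv'|vu'] := leP u v.
  have [h|h] := leP 0 (d - u - v); nra.
have [h|h] := leP 0 (d - u - v); nra.
Qed.

End BoundedDomain.

(** * The two inequalities *)

Section WeightInequalities.
Context {R : realType}.
Implicit Types a b t s : R.

(** Squaring the argument of the right-hand logarithm leaves
    [4 b (a + t) <= ((a + t) + b)^2], the inequality of arithmetic and
    geometric means for [a + t] and [b]. *)
Lemma ln_ratio_le_two_ln_mean a b t : 0 < a -> 0 < b -> 0 <= t ->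
  ln (1 + t / a) <= 2 * ln ((a + b + t) / (2 * Num.sqrt (a * b))).
Proof.
move=> a0 b0 t0; have ab0 : 0 < a * b by rewrite mulr_gt0.
have q0 : 0 < Num.sqrt (a * b) by rewrite sqrtr_gt0.
have m0 : 0 < (a + b + t) / (2 * Num.sqrt (a * b)).
  by rewrite divr_gt0 ?mulr_gt0// ltr_wpDr// addr_gt0.
have ta0 : 0 <= t / a by rewrite divr_ge0// ltW.
rewrite mulr_natl -lnXn// ler_ln ?posrE ?exprn_gt0//; last by rewrite ltr_wpDr.
rewrite expr_div_n exprMn sqr_sqrtr ?(ltW ab0)//.
rewrite ler_pdivlMr ?mulr_gt0//.
have -> : (1 + t / a) * (2 ^+ 2 * (a * b)) = 4 * b * (a + t).
  by field; rewrite gt_eqF.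
rewrite -subr_ge0.
have -> : (a + b + t) ^+ 2 - 4 * b * (a + t) = (a + t - b) ^+ 2 by ring.
exact: sqr_ge0.
Qed.

(** The numerator is at most [2 (a + t)] and [sqrt (a b)] is at least [a]. *)
Lemma ln_mean_le_ln_ratio a b t : 0 < a -> a <= b -> b <= a + t ->
  ln ((a + b + t) / (2 * Num.sqrt (a * b))) <= ln (1 + t / a).
Proof.
move=> a0 ab bat; have b0 : 0 < b by exact: lt_le_trans ab.
have t0 : 0 <= t by lra.
have aq : a <= Num.sqrt (a * b).
  by rewrite -[leLHS]gtr0_norm// -sqrtr_sqr ler_wsqrtr// expr2 ler_pM2l.
have q0 := lt_le_trans a0 aq.
have ta0 : 0 <= t / a by rewrite divr_ge0// ltW.
rewrite ler_ln ?posrE; last 2 first.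
- by rewrite divr_gt0 ?mulr_gt0//; lra.
- by rewrite ltr_wpDr.
rewrite ler_pdivrMr ?mulr_gt0//.
apply: le_trans (_ : (1 + t / a) * (2 * a) <= _); last first.
  by rewrite ler_wpM2l ?addr_ge0// ler_pM2l.
have -> : (1 + t / a) * (2 * a) = 2 * (a + t) by field; rewrite gt_eqF.
lra.
Qed.

End WeightInequalities.

Lemma zetaC (R : realType) n (D : set 'rV[R]_n) x y : zeta D x y = zeta D y x.
Proof. by rewrite /zeta minC eucl_distC. Qed.

Lemma istarC (R : realType) n (D : set 'rV[R]_n) x y :
  istar D x y = istar D y x.
Proof.
by rewrite /istar eucl_distC (addrC (eta D x)) (mulrC (eta D x)).
Qed.

Lemma zeta_istar_bounds (R : realType) n (D : set 'rV[R]_n) (x y : 'rV[R]_n) :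
  bounded_domain D -> 'I_n -> D x -> D y ->
  zeta D x y <= istar D x y /\ istar D x y <= 2 * zeta D x y.
Proof.
move=> domD k; wlog xy : x y / eta D x <= eta D y.
  move=> H Dx Dy; have [xy|/ltW yx] := leP (eta D x) (eta D y); first exact: H.
  by rewrite zetaC istarC; exact: H.
move=> Dx Dy; rewrite /zeta /istar (min_idPl xy).
have a0 := eta_gt0 domD k Dx; have b0 := eta_gt0 domD k Dy.
split.
  apply: ln_ratio_le_two_ln_mean => //.
  by rewrite mulr_ge0 ?eucl_dist_ge0// ltW// (eucl_diam_gt0 domD k).
by rewrite ler_pM2l// ln_mean_le_ln_ratio// (eta_lipschitz domD k).
Qed.

(** * Antipodal points of the cube *)

Section SymmetricSet.
Context {R : realType} {n : nat}.
Variable D : set 'rV[R]_n.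
Hypotheses (openD : open D) (symD : forall x, D x -> D (- x)).

Lemma boundaryN p : boundary D p -> boundary D (- p).
Proof.
move: (openD) => /interior_id intD [clp]; rewrite intD => nDp; split.
  move=> B /nbhs_ballP[r /= r0 rB].
  have [q [Dq pq]] := clp _ (nbhsx_ballx p r r0).
  exists (- q); split; first exact: symD.
  by apply: rB; move: pq; rewrite -!ball_normE/= -opprD normrN.
by rewrite intD => /symD; rewrite opprK.
Qed.

Lemma etaN z : eta D (- z) = eta D z.
Proof.
rewrite /eta; suff -> : bdist D (- z) = bdist D z by [].
rewrite /bdist; congr inf; apply/seteqP; split=> _ [p Bp <-].
  exists (- p); first exact: boundaryN.
  by rewrite -[z]opprK eucl_distN opprK.
by exists (- p); [exact: boundaryN | rewrite eucl_distN].
Qed.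

End SymmetricSet.

Definition cube {R : realType} {n : nat} : set 'rV[R]_n := [set x | `|x| < 1].

Section Cube.
Context {R : realType} {n : nat}.
Variable k : 'I_n.
Local Notation D := (@cube R n).
Local Notation e := (delta_mx ord0 k : 'rV[R]_n).

Let norm_e t : `|t *: e| = `|t|.
Proof.
apply/eqP; rewrite eq_le; apply/andP; split.
  have := norm_le_eucl_dist (0 + t *: e) 0.
  by rewrite subr0 eucl_distC eucl_dist_ray add0r.
by have := coord_le_norm (t *: e) k; rewrite !mxE !eqxx mulr1.
Qed.

Lemma cube_domain : bounded_domain D.
Proof.
have D0 : D 0 by rewrite /cube/= normr0.
split; first by exists 0.
- have -> : D = ball 0 1.
    by apply/seteqP; split=> x; rewrite -ball_normE /cube /= sub0r normrN.
  exact: ball_open.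
(* the cube is star-shaped about the origin *)
- have -> : D = \bigcup_(x in D) ((fun t : R => t *: x) @` `[0, 1]).
    apply/seteqP; split=> [x Dx|x [y Dy [t /= t01 <-]]].
      by exists x => //; exists 1; rewrite ?scale1r//= in_itv/= lexx ler01.
    move: t01; rewrite in_itv/= => /andP[t0 t1].
    by rewrite /cube/= normrZ ger0_norm// (le_lt_trans _ Dy)// ler_piMl.
  apply: bigcup_connected.
    by exists 0 => x _; exists 0; rewrite ?scale0r//= in_itv/= lexx ler01.
  move=> x _; apply: connected_continuous_connected.
    by apply/connected_intervalP; exact: interval_is_interval.
  by apply: continuous_subspaceT => t; exact: scalel_continuous.
- by exists 1; split => // M M1 x /ltW x1; exact: le_trans x1 (ltW M1).
Qed.

Let domD := cube_domain.

Let cubeN x : D x -> D (- x). Proof. by rewrite /cube/= normrN. Qed.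

Lemma cube_axis r : 0 <= r < 1 -> D (r *: e).
Proof. by move=> /andP[r0 r1]; rewrite /cube/= norm_e ger0_norm. Qed.

Lemma cube_etaN z : eta D (- z) = eta D z.
Proof. by apply: etaN => //; have [] := domD. Qed.

Lemma bdist_cube_axis r : 0 <= r < 1 -> bdist D (r *: e) <= 1 - r.
Proof.
move=> r01; apply: (@bdist_le_line _ _ _ domD k); first exact: cube_axis.
move=> t; rewrite -scalerDl /cube/= norm_e lerBrDl => /ltW.
by apply: le_trans; exact: ler_norm.
Qed.

Let d := eucl_diam D.

Let d_gt0 : 0 < d. Proof. exact: (eucl_diam_gt0 domD k). Qed.

Lemma eta_cube_axis_le r : 0 <= r < 1 -> eta D (r *: e) <= (1 - r) * d.
Proof.
move=> r01; have Dz := cube_axis r01; have b0 := bdist_gt0 domD k Dz.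
apply: ler_pM; rewrite ?(ltW b0)//.
- by rewrite subr_ge0 ltW// (bdist_lt_diam domD k).
- exact: bdist_cube_axis.
- by rewrite gerBl ltW.
Qed.

Lemma eucl_dist_antipodal r : 0 <= r ->
  eucl_dist (r *: e) (- (r *: e)) = 2 * r.
Proof.
move=> r0; have := eucl_dist_line k 0 r (- r).
by rewrite !add0r scaleNr => ->; rewrite ger0_norm; lra.
Qed.

Definition antipodal_ratio r : R := d * (2 * r) / eta D (r *: e).

Lemma antipodal_ratio_gt0 r : 0 < r < 1 -> 0 < antipodal_ratio r.
Proof.
move=> /andP[r0 r1]; apply: divr_gt0; first by rewrite !mulr_gt0.
by apply: (eta_gt0 domD k); apply: cube_axis; rewrite ltW.
Qed.

(** At antipodal points both weights agree, so both distances depend only on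
    the ratio [d |x - y| / eta(x)]. *)
Lemma zeta_antipodal r : 0 < r < 1 ->
  zeta D (r *: e) (- (r *: e)) = ln (1 + antipodal_ratio r).
Proof.
move=> /andP[/ltW r0 r1].
by rewrite /zeta cube_etaN minxx eucl_dist_antipodal.
Qed.

Lemma istar_antipodal r : 0 < r < 1 ->
  istar D (r *: e) (- (r *: e)) = 2 * ln (1 + antipodal_ratio r / 2).
Proof.
move=> /andP[/ltW r0 r1]; have Dz : D (r *: e) by apply: cube_axis; rewrite r0.
have h0 := eta_gt0 domD k Dz.
rewrite /istar cube_etaN eucl_dist_antipodal// -expr2 sqrtr_sqr gtr0_norm//.
congr (2 * ln _); rewrite /antipodal_ratio -/d.
by field; rewrite gt_eqF.
Qed.

(** The weight at [r e] is at most [(1 - r) d], so the ratio is at least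
    [2 r / (1 - r)]; this equals [M] at [r = M / (M + 2)]. *)
Lemma antipodal_ratio_large M : 0 < M ->
  exists2 r, 0 < r < 1 & M <= antipodal_ratio r.
Proof.
move=> M0; have M2 : 0 < M + 2 by rewrite addr_gt0.
set r := M / (M + 2).
have r01 : 0 < r < 1 by rewrite divr_gt0//= ltr_pdivrMr// mul1r ltrDl.
exists r => //; have /andP[r0 r1] := r01.
have r01' : 0 <= r < 1 by rewrite ltW.
have h0 := eta_gt0 domD k (cube_axis r01').
rewrite ler_pdivlMr//.
apply: le_trans (_ : M * ((1 - r) * d) <= _).
  by rewrite ler_pM2l// eta_cube_axis_le.
suff -> : M * ((1 - r) * d) = d * (2 * r) by [].
by rewrite /r; field; rewrite gt_eqF.
Qed.

(** By the Lipschitz bound the weight at [r e] is at least [h - d r] with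
    [h = eta(0)]; the witness [r] solves [2 d r = m (h - d r)]. *)
Lemma antipodal_ratio_small m : 0 < m ->
  exists2 r, 0 < r < 1 & antipodal_ratio r <= m.
Proof.
move=> m0.
have m2 : 0 < m + 2 by rewrite addr_gt0.
have D0 : D 0 by rewrite /cube/= normr0.
set h := eta D 0; have h0 : 0 < h := eta_gt0 domD k D0.
have hd : h <= d.
  have := @eta_cube_axis_le 0; rewrite scale0r subr0 mul1r; apply.
  by rewrite lexx ltr01.
set r := m * h / (d * (m + 2)).
have r01 : 0 < r < 1.
  apply/andP; split; first by apply: divr_gt0; rewrite mulr_gt0.
  (* [r < 1] amounts to [m h < (m + 2) d], which [h <= d] gives *)
  by rewrite ltr_pdivrMr ?mulr_gt0// mul1r; nra.
exists r => //; have /andP[r0 r1] := r01.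
have r01' : 0 <= r < 1 by rewrite ltW.
have Dz := cube_axis r01'.
have lip := eta_lipschitz domD k Dz D0.
have := eucl_dist_ray k 0 r; rewrite add0r gtr0_norm// eucl_distC => dr.
rewrite -/h -/d dr in lip.
rewrite ler_pdivrMr ?(eta_gt0 domD k)//.
apply: le_trans (_ : m * (h - d * r) <= _).
  suff -> : m * (h - d * r) = d * (2 * r) by [].
  by rewrite /r; field; rewrite !gt_eqF.
by rewrite ler_pM2l// lerBlDr.
Qed.

End Cube.

(** * Sharpness of the constants *)

Section Sharpness.
Context {R : realType}.
Implicit Types c C s : R.

(** Both [2 ln (1 + s / 2)] and [ln (1 + s)] are equivalent to [s] at [0];
    quantitatively the first is at most [s] and the second is at least
    [s / (1 + s)]. *)
Lemma lower_constant_le c s : 0 < s -> 0 < c ->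
  c * ln (1 + s) <= 2 * ln (1 + s / 2) -> c <= 1 + s.
Proof.
move=> s0 c0 H; have s1 : 0 < 1 + s by rewrite addr_gt0.
have up : 2 * ln (1 + s / 2) <= s.
  have : ln (1 + s / 2) <= s / 2.
    by apply: le_ln1Dx; rewrite (lt_trans (ltrN10 _))// divr_gt0.
  lra.
have lo : s / (1 + s) <= ln (1 + s).
  have : ln (1 + (- (s / (1 + s)))) <= - (s / (1 + s)).
    by apply: le_ln1Dx; rewrite ltrN2 ltr_pdivrMr// mul1r ltrDr.
  have -> : 1 + (- (s / (1 + s))) = (1 + s)^-1 by field; rewrite gt_eqF.
  by rewrite lnV ?posrE// lerN2.
have : c * (s / (1 + s)) <= s.
  by apply: le_trans (le_trans _ H) up; rewrite ler_pM2l.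
rewrite mulrA ler_pdivrMr// mulrC ler_pM2l//.
Qed.

(** This follows from [1 + s / 2 >= (1 + s) / 2]; for [C < 2] the conclusion
    would bound [ln (1 + s)]. *)
Lemma upper_constant_defect C s : 0 < s ->
  2 * ln (1 + s / 2) <= C * ln (1 + s) -> (2 - C) * ln (1 + s) <= 2 * ln 2.
Proof.
move=> s0 H; have s1 : 0 < 1 + s by rewrite addr_gt0.
have : ln ((1 + s) / 2) <= ln (1 + s / 2).
  rewrite ler_ln ?posrE ?addr_gt0 ?divr_gt0//; lra.
rewrite ln_div ?posrE// => h; lra.
Qed.

End Sharpness.

Unset Implicit Arguments.

Theorem proposition3p7 (R : realType) (n : nat) (hn : (2 <= n)%N) :
  (forall D : set 'rV[R]_n, bounded_domain D ->
     forall x y : 'rV[R]_n, D x -> D y ->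
       zeta D x y <= istar D x y /\ istar D x y <= 2 * zeta D x y) /\
  (forall c C : R, 0 < c -> 0 < C ->
     (forall D : set 'rV[R]_n, bounded_domain D ->
        forall x y : 'rV[R]_n, D x -> D y ->
          c * zeta D x y <= istar D x y /\ istar D x y <= C * zeta D x y) ->
     c <= 1 /\ 2 <= C).
Proof.
have k : 'I_n by exact: Ordinal (ltnW hn).
split=> [D domD x y|c C c0 C0 H]; first exact: zeta_istar_bounds.
have {}H r : 0 < r < 1 -> let s := antipodal_ratio k r in
    c * ln (1 + s) <= 2 * ln (1 + s / 2) /\ 2 * ln (1 + s / 2) <= C * ln (1 + s).
  move=> r01 s; rewrite -zeta_antipodal// -istar_antipodal//.
  have Dz : cube (r *: delta_mx ord0 k).
    by apply: cube_axis; have /andP[/ltW -> ->] := r01.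
  by apply: (H _ cube_domain) => //; rewrite /cube/= normrN.
split.
  apply/ler_addgt0Pr => m m0.
  have [r r01 sm] := antipodal_ratio_small k m0.
  apply: le_trans (lower_constant_le (antipodal_ratio_gt0 k r01) c0 (H r r01).1) _.
  by rewrite lerD2l.
rewrite leNgt; apply/negP => C2.
(* any logarithm above [2 ln 2 / (2 - C)] contradicts [upper_constant_defect] *)
pose L : R := (2 * ln 2 + 1) / (2 - C).
have [r r01 sL] := antipodal_ratio_large k (expR_gt0 L).
have s0 := antipodal_ratio_gt0 k r01.
have /(upper_constant_defect s0) := (H r r01).2.
apply/negP; rewrite -ltNge.
apply: lt_le_trans (_ : (2 - C) * L <= _).
  by rewrite [ltRHS]mulrC divfK ?ltrDl// gt_eqF// subr_gt0.
rewrite ler_pM2l ?subr_gt0// -[L]expRK ler_ln ?posrE ?expR_gt0 ?addr_gt0//.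
by rewrite ler_wpDl.
Qed.
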